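(* Let $$g(\lambda)=\sqrt{\frac{\tanh\sqrt\lambda}{\sqrt\lambda}},\qquad \lambda>0.$$ Then $\lambda\mapsto (g(\lambda))^{2\alpha}$ is a Stieltjes function for any $\alpha\in(0,1]$.
   Context: A function $h\colon(0,\infty)\to[0,\infty)$ is called a (nonnegative) Stieltjes function if it can be written in the form $$h(\lambda)=\frac a\lambda+b+\int_{(0,\infty)}\frac1{\lambda+t}\,d\sigma(t),$$ where $a,b\ge0$ are constants and $\sigma$ is a (positive) Borel measure on $(0,\infty)$ with $\int_{(0,\infty)}\frac{d\sigma(t)}{1+t}<\infty$. *)

(* Defs.v *)
From HB Require Import structures.
From mathcomp Require Import all_boot all_order all_algebra.
From mathcomp Require Import all_classical all_reals all_analysis.

Set Implicit Arguments.
Unset Strict Implicit.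
Unset Printing Implicit Defensive.

Import Order.TTheory GRing.Theory Num.Theory.
Import numFieldNormedType.Exports.

Local Open Scope classical_set_scope.
Local Open Scope ring_scope.

Definition sinh (R : realType) (x : R) : R := (expR x - expR (- x)) / 2.

Definition cosh (R : realType) (x : R) : R := (expR x + expR (- x)) / 2.

Definition tanh (R : realType) (x : R) : R := sinh x / cosh x.

(* A function on (0, +oo) is encoded by a total function [h : R -> R] of which
   only the values at positive arguments matter.  A Borel measure on (0, +oo) is
   encoded by a Borel measure on R of which only the restriction to (0, +oo)
   matters: every integral is over `]0, +oo[.  The representation is an equality
   of extended reals, so no junk value of the integral is involved. *)
Definition stieltjes_function (R : realType) (h : R -> R) : Prop :=
  (forall l : R, 0 < l -> 0 <= h l) /\
  exists (a b : R) (sigma : {measure set (measurableTypeR R) -> \bar R}),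
    [/\ 0 <= a, 0 <= b,
        (\int[sigma]_(t in `]0%R, +oo[) ((1 + t)^-1)%:E < +oo)%E &
        forall l : R, 0 < l ->
          ((h l)%:E = (a / l + b)%:E
                      + \int[sigma]_(t in `]0%R, +oo[) ((l + t)^-1)%:E)%E].

Definition g (R : realType) (l : R) : R :=
  Num.sqrt (tanh (Num.sqrt l) / Num.sqrt l).

(* Main.v *)
(* tanh(sqrt l) / sqrt l is the limit of the products of the factors
   (1 + l / b_i) / (1 + l / a_i) with a_0 < b_0 < a_1 < b_1 < ... (the squares of
   the odd, resp. positive even, multiples of pi / 2); only the ratio of the Euler
   products is needed, and it follows from the Wallis-type recursion for the
   integrals of cosh (x t) cos^n t over [0, pi / 2].

   The alpha-th power of one factor is a constant plus the Cauchy transform of a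
   measure carried by [a_i, b_i]; this is a change of variables in
   r^alpha = c \int_0^oo r / (r + v^(1/alpha)) dv.  Since the intervals are
   disjoint, partial fractions and Fubini show that multiplying by one more
   factor multiplies the measure already built by the new factor, evaluated at
   negative arguments where it is at least 1, and adds a new piece on the new
   interval.  The measures of the finite products therefore increase, so the
   limit measure is a series of nonnegative increments and no compactness
   argument is needed. *)
Require Import Defs.
From HB Require Import structures.
From mathcomp Require Import all_boot all_order all_algebra.
From mathcomp Require Import all_classical all_reals all_analysis.
From mathcomp Require Import measurable_realfun.
From mathcomp Require Import ring lra.

Set Implicit Arguments.
Unset Strict Implicit.
Unset Printing Implicit Defensive.

Import Order.TTheory GRing.Theory Num.Theory.
Import numFieldNormedType.Exports.
Local Open Scope classical_set_scope.
Local Open Scope ring_scope.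

(** * Measures with a density *)

Section density.
Local Open Scope ereal_scope.
Context d (T : measurableType d) (R : realType).
Variables (mu : {measure set T -> \bar R}) (D : T -> R).
Hypothesis mD : measurable_fun setT D.
Hypothesis D0 : forall x, (0 <= D x)%R.

Definition density_measure (A : set T) : \bar R := \int[mu]_(x in A) (D x)%:E.

Let density_measure0 : density_measure set0 = 0.
Proof. exact: integral_set0. Qed.

Let density_measure_ge0 A : 0 <= density_measure A.
Proof. by apply: integral_ge0 => x _; rewrite lee_fin. Qed.

Let density_measure_sigma_additive : semi_sigma_additive density_measure.
Proof.
move=> F mF tF mUF; rewrite /density_measure.
rewrite ge0_integral_bigcup//=.
- apply: is_cvg_ereal_nneg_natsum_cond => n _ _.
  exact: density_measure_ge0.
- by apply/measurable_EFinP; exact: measurable_funTS.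
- by move=> x _; rewrite lee_fin.
Qed.

HB.instance Definition _ := isMeasure.Build d T R density_measure
  density_measure0 density_measure_ge0 density_measure_sigma_additive.

Import HBNNSimple.

(** Monotone convergence along simple functions increasing to [f], applied to both sides, reduces
    the identity to one simple function; on each of its level sets the identity is the definition of
    [density_measure]. *)
Let integral_density_measure (f : T -> \bar R) :
  measurable_fun setT f -> (forall x, 0 <= f x) ->
  \int[density_measure]_x f x = \int[mu]_x (f x * (D x)%:E).
Proof.
move=> mf f0.
have mDE : measurable_fun setT (EFin \o D) by exact/measurable_EFinP.
pose g := nnsfun_approx measurableT mf.
have gf x : EFin \o g ^~ x @ \oo --> f x.
  by apply: cvg_nnsfun_approx => // y _.
transitivity (limn (fun n => \int[density_measure]_x (g n x)%:E)).
  rewrite -monotone_convergence//.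
  - by apply: eq_integral => x _; apply/esym/cvg_lim => //; exact: gf.
  - by move=> n; exact/measurable_EFinP.
  - by move=> n x _; rewrite lee_fin.
  - by move=> x _ a b ab; rewrite lee_fin; exact/lefP/nd_nnsfun_approx.
have mgD n : measurable_fun setT (fun x => (g n x)%:E * (D x)%:E).
  by apply: emeasurable_funM => //; exact/measurable_EFinP.
transitivity (limn (fun n => \int[mu]_x ((g n x)%:E * (D x)%:E))); last first.
  rewrite -monotone_convergence//.
  - apply: eq_integral => x _; apply/cvg_lim => //.
    by apply: cvgeZr => //; exact: gf.
  - by move=> n x _; rewrite mule_ge0 ?lee_fin.
  - move=> x _ a b ab; apply: lee_wpmul2r; first by rewrite lee_fin.
    by rewrite lee_fin; exact/lefP/nd_nnsfun_approx.
congr (limn _); apply/funext => n.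
rewrite integralT_nnsfun sintegralE.
rewrite [RHS](_ : _ = \int[mu]_x \sum_(y \in range (g n))
    (y%:E * ((\1_(g n @^-1` [set y]) x)%:E * (D x)%:E))); last first.
  apply: eq_integral => x _.
  rewrite {1}(fimfunE (g n) x) -fsumEFin// ge0_mule_fsuml//.
    by apply: eq_fsbigr => y _; rewrite EFinM muleA.
  by move=> y; rewrite nnfun_muleindic_ge0.
rewrite ge0_integral_fsum//; last 2 first.
  - move=> y; apply: measurable_funeM; apply: emeasurable_funM => //.
    by apply/measurable_EFinP; exact: measurable_indic.
  - move=> y x _; rewrite muleA mule_ge0 ?lee_fin//.
    by have := nnfun_muleindic_ge0 (g n) y x; rewrite -EFinM lee_fin.
apply: eq_fsbigr => y; rewrite inE => -[x _ <-].
rewrite ge0_integralZl//; last 3 first.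
  - by apply: emeasurable_funM => //; apply/measurable_EFinP; exact: measurable_indic.
  - by move=> z _; rewrite mule_ge0 ?lee_fin.
  - by rewrite lee_fin.
congr (_ * _); rewrite /= /density_measure integral_mkcond; apply: eq_integral => z _.
by rewrite patchE indicE; case: ifPn; rewrite ?mul1e ?mul0e.
Qed.

Lemma measure_with_density : exists nu : {measure set T -> \bar R},
  forall f : T -> \bar R, measurable_fun setT f -> (forall x, 0 <= f x) ->
  \int[nu]_x f x = \int[mu]_x (f x * (D x)%:E).
Proof.
exists (density_measure : {measure set T -> \bar R}).
exact: integral_density_measure.
Qed.
End density.

(** The same measure is repackaged with the finiteness structure, which gives integrability of
    bounded functions and Fubini. *)
Lemma finite_measure_of d (T : measurableType d) (R : realType)
    (nu : {measure set T -> \bar R}) : (nu setT < +oo)%E ->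
  exists m : {finite_measure set T -> \bar R}, forall D f,
    (\int[m]_(x in D) f x = \int[nu]_(x in D) f x)%E.
Proof.
move=> fin.
have H : fin_num_fun nu.
  by move=> A mA; rewrite ge0_fin_numE// (le_lt_trans _ fin)// le_measure ?inE.
have HF : sigma_finite setT nu.
  by apply: fin_num_fun_sigma_finite; rewrite ?measure0.
pose H1 := isFinite.Build _ _ _ _ H.
pose H2 := isSFinite.Build _ _ _ _ (sfinite_measure_sigma_finite HF).
pose H3 := isSigmaFinite.Build _ _ _ _ HF.
pose m := HB.pack_for (FiniteMeasure.type T R) (Measure.sort nu) H1 H2 H3.
by exists m.
Qed.

(** The formula $y^{-1}=y\,(y^2)^{-1}$ expresses inversion through a real power, which is measurable
    on the whole line. At $y=0$ both sides are 0 by convention. *)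
Lemma measurable_funV d (T : measurableType d) (R : realType) (D : set T)
    (f : T -> R) : measurable_fun D f -> measurable_fun D (fun x => (f x)^-1).
Proof.
move=> mf; rewrite (_ : (fun _ => _) = fun x => f x * (f x ^+ 2) `^ (- 1)).
  apply: measurable_funM => //.
  apply: (measurableT_comp (measurable_powR _)); exact: measurable_funX.
apply/funext => x; rewrite powR_inv1 ?sqr_ge0//.
have [->|f0] := eqVneq (f x) 0; first by rewrite invr0 mul0r.
by field.
Qed.

(** * Powers as Cauchy transforms *)

Section powR_stieltjes.
Context {R : realType}.
Local Notation mu := (@lebesgue_measure R).
Variable p : R.
Hypothesis p1 : 1 < p.
Implicit Types r v : R.

Let p0 : 0 < p. Proof. exact: lt_trans p1. Qed.

(** Up to a constant factor, its integral over $v\ge0$ is $r^{1/p}$; it is used with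
    $p=1/\alpha$. *)
Definition resolvent_powR r v : R := r / (r + v `^ p).

Lemma resolvent_powR_ge0 r v : 0 < r -> 0 <= resolvent_powR r v.
Proof. by move=> r0; rewrite divr_ge0 ?ltW// ltr_wpDr ?powR_ge0. Qed.

Lemma measurable_resolvent_powR r : measurable_fun setT (resolvent_powR r).
Proof.
apply: measurable_funM => //; apply: measurable_funV.
by apply: measurable_funD => //; exact: measurable_powR.
Qed.

Lemma within_continuous_powR : {within `[0, +oo[, continuous (fun v : R => v `^ p)}.
Proof.
apply: derivable_oy_Rcontinuous_within_itvcy; split.
  by move=> x x0; exact: derivable_powR.
by rewrite powR0 ?gt_eqF//; exact: powR_cvg0.
Qed.

Lemma within_continuous_resolvent r : 0 < r ->
  {within `[0, +oo[, continuous (resolvent_powR r)}.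
Proof.
move=> r0 v; apply: cvgM; first exact: cvg_cst.
apply: cvgV; first by rewrite gt_eqF// ltr_wpDr ?powR_ge0.
by apply: cvgD; [exact: cvg_cst|exact: within_continuous_powR].
Qed.

Definition resolvent_int r := (\int[mu]_(v in `[0%R, +oo[) (resolvent_powR r v)%:E)%E.

(** Substituting $v\mapsto r^{1/p}v$ turns $r/(r+v^p)$ into $1/(1+v^p)$, and the Jacobian $r^{1/p}$
    comes out. *)
Lemma resolvent_int_scale r : 0 < r ->
  resolvent_int r = ((r `^ p^-1)%:E * resolvent_int 1)%E.
Proof.
move=> r0; set s := r `^ p^-1.
have s0 : 0 < s by exact: powR_gt0.
have sp : s `^ p = r by rewrite /s -powRrM mulVf ?gt_eqF// powRr1 ?ltW.
have dF (x : R) : is_derive x 1 (fun v : R => s * v) s.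
  by apply: is_derive_eq; rewrite /GRing.scale /= mulr1.
have dFE : (fun v : R => s * v)^`()%classic = cst s.
  by apply/funext => x; rewrite derive1E derive_val.
have F0 : s * 0 = 0 by rewrite mulr0.
(* The lower endpoint 0 is rewritten as the image [s * 0] of 0 under the substitution. *)
rewrite /resolvent_int -{1}F0.
rewrite (@increasing_ge0_integration_by_substitutiony _ (fun v => s * v)).
- rewrite dFE -ge0_integralZl//.
  + apply: eq_integral => v; rewrite inE/= in_itv/= andbT => v0.
    transitivity ((resolvent_powR r (s * v) * s)%:E) => //.
    rewrite -EFinM /resolvent_powR powRM ?(ltW s0)// sp; congr EFin.
    have v1 : 0 < 1 + v `^ p by rewrite ltr_wpDr ?powR_ge0.
    have r1 : 0 < r + r * v `^ p .
      by apply: ltr_wpDr => //; apply: mulr_ge0; [exact: ltW|exact: powR_ge0].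
    by field; rewrite !gt_eqF.
  + by apply/measurable_EFinP; apply: measurable_funTS; exact: measurable_resolvent_powR.
  + by move=> v _; rewrite lee_fin resolvent_powR_ge0.
  + by rewrite lee_fin ltW.
- by move=> x y _ _ xy; rewrite ltr_pM2l.
- by rewrite dFE => x _; exact: cvg_cst.
- by rewrite dFE; exact: is_cvg_cst.
- by rewrite dFE; exact: is_cvg_cst.
- split; first by move=> x _.
  by apply: cvg_at_right_filter; apply: cvgM; [exact: cvg_cst|exact: cvg_id].
- exact: gt0_cvgMry.
- by rewrite F0; exact: within_continuous_resolvent.
- by move=> v _; exact: resolvent_powR_ge0.
Qed.

Lemma powR_neg_cvgy (q : R) : 0 < q -> v `^ (- q) @[v --> +oo] --> (0 : R).
Proof.
move=> q0; apply/cvgrPdist_le => /= e e0.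
near=> v.
have vM : (e^-1) `^ q^-1 <= v by near: v; exact: nbhs_pinfty_ge.
have v0 : 0 < v by apply: lt_le_trans vM; rewrite powR_gt0// invr_gt0.
rewrite sub0r normrN ger0_norm ?powR_ge0// powRN -[leRHS]invrK.
rewrite lef_pV2 ?posrE ?powR_gt0 ?invr_gt0//.
have Me : (e^-1 `^ q^-1) `^ q = e^-1.
  by rewrite -powRrM mulVf ?gt_eqF// powRr1// invr_ge0 ltW.
by rewrite -Me; apply: ge0_ler_powR => //; rewrite ?nnegrE ?powR_ge0 ?ltW.
Unshelve. all: by end_near. Qed.

(** The integrand is at most 1 on $[0,1)$ and at most $v^{-p}$ on $[1,\infty)$. The latter has the
    primitive [F], which tends to 0 at infinity because $p>1$. *)
Lemma resolvent_int1_lty : (resolvent_int 1 < +oo)%E.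
Proof.
pose F v : R := (1 - p)^-1 * v `^ (1 - p).
have dF (x : R) : 0 < x -> is_derive x 1 F (x `^ (- p)).
  move=> x0; have h := is_derive1_powR (1-p) x0.
  apply: is_derive_eq; rewrite /GRing.scale /= mulrA mulVf ?mul1r.
    by congr (_ `^ _); ring.
  by rewrite subr_eq0 lt_eqF.
have cF (x : R) : 0 < x -> {for x, continuous F}.
  move=> x0; apply: differentiable_continuous; apply/derivable1_diffP.
  exact: (@ex_derive _ _ _ _ _ _ _ (dF x x0)).
have mr := @measurable_resolvent_powR 1.
have tail : (\int[mu]_(v in `[1%R, +oo[) (v `^ (-p))%:E < +oo)%E.
  rewrite (@ge0_continuous_FTC2y _ (fun v => v `^ (-p)) F 1 0).
  - by rewrite -EFinB ltry.
  - by move=> x _; exact: powR_ge0.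
  - apply: continuous_in_subspaceT => x; rewrite inE/= in_itv/= andbT => x1.
    apply: differentiable_continuous; apply/derivable1_diffP.
    by apply: derivable_powR; rewrite in_itv/= andbT; exact: lt_le_trans x1.
  - have h : v `^ (1 - p) @[v --> +oo] --> (0 : R).
      by rewrite -(opprB p); apply: powR_neg_cvgy; rewrite subr_gt0.
    by rewrite -[X in _ --> X](mulr0 (1 - p)^-1); exact: cvgMl_tmp h.
  - by move=> x x1; apply: (@ex_derive _ _ _ _ _ _ _ (dF x _)); exact: lt_trans x1.
  - by apply: cvg_at_right_filter; exact: cF.
  - move=> x; rewrite in_itv/= andbT => x1.
    by rewrite derive1E (@derive_val _ _ _ _ _ _ _ (dF x (lt_trans ltr01 x1))).
rewrite /resolvent_int.
have -> : `[0%R, +oo[%classic = `[0%R, 1[%classic `|` `[1%R, +oo[%classic :> set R.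
  by rewrite -(@itv_bndbnd_setU _ _ _ (BLeft 1))// bnd_simp.
rewrite ge0_integral_setU//=; last 3 first.
- by apply/measurable_EFinP; apply: measurable_funTS.
- by move=> v _; rewrite lee_fin resolvent_powR_ge0.
- apply/disj_setPS => v /= []; rewrite !in_itv/= andbT => /andP[_ v1].
  by rewrite leNgt v1.
apply: lte_add_pinfty.
- apply: (@le_lt_trans _ _ (\int[mu]_(v in `[0%R, 1%R[) 1%:E)%E).
    apply: ge0_le_integral => //.
    + by move=> v _; rewrite lee_fin resolvent_powR_ge0.
    + by apply/measurable_EFinP; apply: measurable_funTS.
    + move=> v _; rewrite lee_fin /resolvent_powR ler_pdivrMr ?mul1r ?lerDl ?powR_ge0//.
      by rewrite ltr_wpDr ?powR_ge0.
  by rewrite integral_cst//= mul1e lebesgue_measure_itv/= lte_fin ltr01 ltry.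
- apply: le_lt_trans tail; apply: ge0_le_integral => //.
  + by move=> v _; rewrite lee_fin resolvent_powR_ge0.
  + by apply/measurable_EFinP; apply: measurable_funTS.
  + by apply/measurable_EFinP; apply: measurable_funTS; exact: measurable_powR.
  + move=> v /=; rewrite in_itv/= andbT => v1.
    have v0 : 0 < v by exact: lt_le_trans v1.
    rewrite lee_fin /resolvent_powR powRN div1r lef_pV2 ?posrE ?powR_gt0//.
      by rewrite lerDr.
    by rewrite ltr_wpDr ?powR_ge0.
Qed.

Lemma resolvent_int_fin r : 0 < r ->
  resolvent_int r = (r `^ p^-1 * fine (resolvent_int 1))%:E.
Proof.
move=> r0; rewrite resolvent_int_scale// EFinM fineK// ge0_fin_numE ?resolvent_int1_lty//.
by apply: integral_ge0 => v _; rewrite lee_fin resolvent_powR_ge0.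
Qed.

(** The integrand is at least $1/2$ on $[0,1]$. Positivity allows this constant to serve as a
    normalizing divisor. *)
Lemma resolvent_int1_gt0 : 0 < fine (resolvent_int 1).
Proof.
have mr := @measurable_resolvent_powR 1.
rewrite fine_gt0// resolvent_int1_lty andbT.
apply: (@lt_le_trans _ _ (\int[mu]_(v in `[0%R, 1%R]) (2^-1)%:E)%E).
  rewrite integral_cst//= lebesgue_measure_itv/= lte_fin ltr01 oppr0 adde0 mule1.
  by rewrite lte_fin invr_gt0.
apply: (@le_trans _ _ (\int[mu]_(v in `[0%R, 1%R]) (resolvent_powR 1 v)%:E)%E).
  apply: ge0_le_integral => //.
  - by apply/measurable_EFinP; apply: measurable_funTS.
  - move=> v /=; rewrite in_itv/= => /andP[v0 v1].
    rewrite lee_fin /resolvent_powR div1r lef_pV2 ?posrE//; last first.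
      by rewrite ltr_wpDr ?powR_ge0.
    have := @ge0_ler_powR R p (ltW p0) v 1; rewrite powR1 !nnegrE => /(_ v0 ler01 v1).
    lra.
apply: ge0_subset_integral => //.
- by apply/measurable_EFinP; apply: measurable_funTS.
- by move=> v _; rewrite lee_fin resolvent_powR_ge0.
- by move=> v /=; rewrite !in_itv/= => /andP[-> _].
Qed.

End powR_stieltjes.

(* At alpha = 1 the integral of 1 / (1 + v^(1/alpha)) diverges and the measure
   degenerates to a point mass. *)
Lemma powR_representation (R : realType) (alpha : R) : 0 < alpha -> alpha <= 1 ->
  exists (m : {finite_measure set (measurableTypeR R) -> \bar R})
         (th : measurableTypeR R -> R),
    [/\ measurable_fun setT th, forall v, 0 <= th v <= 1 &
      forall r, 0 < r ->
        r `^ alpha = 1 + (r - 1) * \int[m]_v (1 + (r - 1) * th v)^-1].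
Proof.
move=> a0; rewrite le_eqVlt => /predU1P[->|a1].
  (* For $\alpha=1$, [th = 0] makes the integrand 1, and a unit mass gives $1+(r-1)=r$. *)
  exists (dirac (0 : measurableTypeR R)), (cst 0); split => //.
  - by move=> v; rewrite lexx ler01.
  - move=> r r0; rewrite /Rintegral.
    have -> : (fun v : measurableTypeR R => ((1 + (r - 1) * cst 0 v)^-1)%:E) = cst (1%:E).
      by apply/funext => v; rewrite /= mulr0 addr0 invr1.
    rewrite integral_dirac// diracT mul1e /= mulr1 addrC subrK powRr1 ?ltW//.
pose p := alpha^-1.
have p1 : 1 < p by rewrite invf_gt1.
have pK : p^-1 = alpha by rewrite invrK.
pose mu := @lebesgue_measure R.
pose k := fine (resolvent_int p 1).
have k0 : 0 < k by exact: resolvent_int1_gt0.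
pose u (v : measurableTypeR R) : R := v `^ p.
have u0 v : 0 <= u v by exact: powR_ge0.
have u1 v : 0 < 1 + u v by rewrite ltr_wpDr.
have mu_ : measurable_fun setT u by exact: measurable_powR.
have mu1 : measurable_fun setT (fun v => (1 + u v)^-1).
  by apply: measurable_funV; apply: measurable_funD.
(* With [th] equal to $1/(1+u)$ the kernel is $(1+u)/(r+u)$. This density makes $(r-1)$ times the
   weighted kernel equal to $\frac1k\bigl(\frac r{r+u}-\frac1{1+u}\bigr)$, whose integral is
   $r^\alpha-1$. *)
pose D v := \1_(`[0, +oo[%classic : set R) v * (u v * (1 + u v)^-1 * (1 + u v)^-1 / k).
have D0 v : 0 <= D v by rewrite !mulr_ge0 ?invr_ge0 ?(ltW (u1 _)) ?(ltW k0).
have mD : measurable_fun setT D.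
  apply: measurable_funM; first exact: measurable_indic.
  by do 3 (apply: measurable_funM => //).
have [nu nuE] := measure_with_density mu mD D0.
have resI r : 0 < r -> mu.-integrable `[0, +oo[ (EFin \o resolvent_powR p r).
  move=> r0; apply/integrableP; split.
    by apply/measurable_EFinP; apply: measurable_funTS; exact: measurable_resolvent_powR.
  under eq_integral do rewrite /= ger0_norm ?resolvent_powR_ge0//.
  by rewrite -/(resolvent_int p r) resolvent_int_fin// ltry.
have resE r : 0 < r -> \int[mu]_(v in `[0, +oo[) resolvent_powR p r v = r `^ alpha * k.
  by move=> r0; rewrite /Rintegral -/(resolvent_int p r) resolvent_int_fin// pK.
have nuE2 (f : measurableTypeR R -> R) : measurable_fun setT f -> (forall v, 0 <= f v) ->
    (\int[nu]_v (f v)%:E =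
     \int[mu]_(v in `[0%R, +oo[) (f v * (u v * (1 + u v)^-1 * (1 + u v)^-1 / k))%:E)%E.
  move=> mf f0; rewrite nuE//; last exact/measurable_EFinP.
  rewrite [RHS]integral_mkcond; apply: eq_integral => v _.
  rewrite patchE /D indicE; case: ifPn => _; first by rewrite mul1r.
  by rewrite mul0r mule0.
(* Since $u/(1+u)\le1$, the density is dominated by $k^{-1}/(1+u)$, a multiple of the integrable
   resolvent at $r=1$. *)
have nufin : (nu setT < +oo)%E.
  have -> : nu setT = (\int[nu]_v (cst 1%E v))%E by rewrite integral_cst// mul1e.
  rewrite (nuE2 (cst 1))//.
  apply: (@le_lt_trans _ _
      (\int[mu]_(v in `[0%R, +oo[) (k^-1 * resolvent_powR p 1 v)%:E)%E).
    apply: ge0_le_integral => //.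
    - by move=> v _; rewrite lee_fin mul1r !mulr_ge0 ?invr_ge0 ?(ltW (u1 _)) ?(ltW k0).
    - apply/measurable_EFinP; apply: measurable_funTS.
      by do 4 (apply: measurable_funM => //).
    - apply/measurable_EFinP; apply: measurable_funTS; apply: measurable_funM => //.
      exact: measurable_resolvent_powR.
    - move=> v _; rewrite lee_fin mul1r [leRHS]mulrC ler_pM2r ?invr_gt0//.
      rewrite /resolvent_powR ler_pM2r ?invr_gt0// ler_pdivrMr// mul1r.
      by rewrite lerDr.
  under eq_integral do rewrite EFinM.
  rewrite ge0_integralZl//.
  - by rewrite -/(resolvent_int p 1) resolvent_int_fin// -EFinM ltry.
  - apply/measurable_EFinP; apply: measurable_funTS; exact: measurable_resolvent_powR.
  - by move=> v _; rewrite lee_fin resolvent_powR_ge0.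
  - by rewrite lee_fin invr_ge0 ltW.
have [m mE] := finite_measure_of nufin.
exists m, (fun v => (1 + u v)^-1); split => //.
- move=> v; rewrite invr_ge0 (ltW (u1 _))/= invf_le1// lerDl//.
(* The case $r=1$ is set apart because the computation divides by $r-1$. *)
- move=> r r0; have [->|r1] := eqVneq r 1; first by rewrite powR1 subrr mul0r addr0.
  have ru v : 0 < r + u v by rewrite ltr_wpDr.
  have E v : (1 + (r - 1) * (1 + u v)^-1)^-1 = (1 + u v) / (r + u v).
    by field; rewrite !gt_eqF//; have := ru v; lra.
  rewrite /Rintegral mE (@nuE2 (fun v => (1 + (r - 1) * (1 + u v)^-1)^-1)); last 2 first.
  + by apply: measurable_funV; apply: measurable_funD => //; apply: measurable_funM.
  + by move=> v; rewrite E divr_ge0// ltW.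
  have -> : (fun v => ((1 + (r - 1) / (1 + u v))^-1
        * (u v / (1 + u v) / (1 + u v) / k))%:E) =
     (fun v => ((r - 1)^-1 / k * (resolvent_powR p r v - resolvent_powR p 1 v))%:E).
    apply/funext => v; rewrite E /resolvent_powR -/(u v); congr EFin.
    by field; rewrite subr_eq0 r1 !gt_eqF.
  rewrite -/(Rintegral _ _ _) RintegralZl//; last first.
    by apply: (integrableB _ (resI _ r0) (resI _ ltr01)).
  rewrite RintegralB ?resI// !resE// powR1.
  by field; rewrite subr_eq0 r1 gt_eqF.
Qed.

(** * Bounded measurable functions and Fubini *)

(** On a finite measure such functions are integrable, and the class is closed under sums, products
    and partial integration. Integrability side conditions thus reduce to the shape of the
    integrand. *)
Definition bounded_mfun d (T : measurableType d) (R : realType) (f : T -> R) :=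
  measurable_fun setT f /\ exists C, forall x, `|f x| <= C.

Section bounded_mfun.
Context d (T : measurableType d) (R : realType).
Implicit Types f g : T -> R.

Lemma bounded_mfun_cst (c : R) : bounded_mfun (fun _ : T => c).
Proof. by split => //; exists `|c|. Qed.

Lemma bounded_mfunD f g : bounded_mfun f -> bounded_mfun g ->
  bounded_mfun (fun x => f x + g x).
Proof.
move=> [mf [A fA]] [mg [B gB]]; split; first exact: measurable_funD.
by exists (A + B) => x; rewrite (le_trans (ler_normD _ _))// lerD.
Qed.

Lemma bounded_mfunM f g : bounded_mfun f -> bounded_mfun g ->
  bounded_mfun (fun x => f x * g x).
Proof.
move=> [mf [A fA]] [mg [B gB]]; split; first exact: measurable_funM.
by exists (A * B) => x; rewrite normrM ler_pM.
Qed.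

Lemma bounded_mfunB f g : bounded_mfun f -> bounded_mfun g ->
  bounded_mfun (fun x => f x - g x).
Proof.
move=> bf bg; under eq_fun do rewrite -mulN1r.
by apply: bounded_mfunD => //; apply: bounded_mfunM => //; exact: bounded_mfun_cst.
Qed.

Lemma bounded_mfun_sum I (r : seq I) (F : I -> T -> R) :
  (forall i, bounded_mfun (F i)) -> bounded_mfun (fun x => \sum_(i <- r) F i x).
Proof.
move=> bF; elim: r => [|i r IH].
  by under eq_fun do rewrite big_nil; exact: bounded_mfun_cst.
by under eq_fun do rewrite big_cons; exact: bounded_mfunD.
Qed.

Lemma bounded_mfun_prod n (F : nat -> T -> R) :
  (forall i, (i < n)%N -> bounded_mfun (F i)) ->
  bounded_mfun (fun x => \prod_(i < n) F i x).
Proof.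
elim: n => [|n IH] bF.
  by under eq_fun do rewrite big_ord0; exact: bounded_mfun_cst.
under eq_fun do rewrite big_ord_recr/=; apply: bounded_mfunM; last exact: bF.
by apply: IH => i /ltnW; exact: bF.
Qed.

Lemma bounded_mfunV f (c : R) : 0 < c -> measurable_fun setT f ->
  (forall x, c <= `|f x|) -> bounded_mfun (fun x => (f x)^-1).
Proof.
move=> c0 mf fc; split; first exact: measurable_funV.
by exists c^-1 => x; rewrite normfV lef_pV2 ?posrE// (lt_le_trans c0).
Qed.

Lemma bounded_mfun_powR f (p : R) : 0 <= p -> (forall x, 0 <= f x) ->
  bounded_mfun f -> bounded_mfun (fun x => f x `^ p).
Proof.
move=> p0 f0 [mf [C fC]]; split; first exact: (measurableT_comp (measurable_powR _)).
exists (C `^ p) => x; rewrite ger0_norm ?powR_ge0//.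
have fC' : f x <= C by rewrite (le_trans (ler_norm _)).
by apply: ge0_ler_powR => //; rewrite nnegrE// (le_trans _ fC').
Qed.

Lemma bounded_mfun_comp d' (T' : measurableType d') (u : T' -> T) f :
  measurable_fun setT u -> bounded_mfun f -> bounded_mfun (fun x => f (u x)).
Proof.
move=> mu [mf [C fC]]; split; first exact: (measurableT_comp mf).
by exists C => x.
Qed.

Variable m : {finite_measure set T -> \bar R}.

Lemma bounded_mfun_integrable f : bounded_mfun f -> m.-integrable setT (EFin \o f).
Proof.
move=> [mf [C fC]]; apply: measurable_bounded_integrable => //.
  by rewrite -ge0_fin_numE// fin_num_measure.
exists C; split; first exact: num_real.
by move=> M CM x _ /=; apply: le_trans (fC x) _; exact: ltW.
Qed.

Lemma fineK_bounded_mfun f : bounded_mfun f ->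
  (\int[m]_x f x)%:E = (\int[m]_x (f x)%:E)%E.
Proof.
by move=> bf; rewrite fineK// integrable_fin_num//; exact: bounded_mfun_integrable.
Qed.

Lemma bounded_mfun_RintegralD f g : bounded_mfun f -> bounded_mfun g ->
  \int[m]_x (f x + g x) = \int[m]_x f x + \int[m]_x g x.
Proof. by move=> bf bg; rewrite RintegralD//; exact: bounded_mfun_integrable. Qed.

Lemma bounded_mfun_RintegralZl f c : bounded_mfun f ->
  \int[m]_x (c * f x) = c * \int[m]_x f x.
Proof. by move=> bf; rewrite RintegralZl//; exact: bounded_mfun_integrable. Qed.

Lemma bounded_mfun_Rintegral_sum I (r : seq I) (F : I -> T -> R) :
  (forall i, bounded_mfun (F i)) ->
  \int[m]_x (\sum_(i <- r) F i x) = \sum_(i <- r) \int[m]_x F i x.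
Proof.
move=> bF; elim: r => [|i r IH].
  by under eq_Rintegral do rewrite big_nil; rewrite Rintegral_cst// mul0r big_nil.
under eq_Rintegral do rewrite big_cons.
by rewrite bounded_mfun_RintegralD// ?IH ?big_cons//; exact: bounded_mfun_sum.
Qed.
End bounded_mfun.

Section bounded_fubini.
Context d (T : measurableType d) (R : realType).
Variable m : {finite_measure set T -> \bar R}.
Implicit Types F : T * T -> R.

Let integrable_prod F : bounded_mfun F -> (m \x m)%E.-integrable setT (EFin \o F).
Proof.
move=> [mF [C FC]]; apply/integrable12ltyP; first exact/measurable_EFinP.
apply: (@le_lt_trans _ _ (\int[m]_x \int[m]_y (cst C%:E y))%E).
  apply: ge0_le_integral => //.
  - by move=> x _; exact: integral_ge0.
  - apply: (measurable_fun_fubini_tonelli_F (abse \o (EFin \o F))) => //.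
    + by apply: measurableT_comp => //; exact/measurable_EFinP.
    + by move=> x; exact: abse_ge0.
  - move=> x _; apply: ge0_le_integral => //.
    + apply/measurable_EFinP; apply: measurableT_comp => //.
      exact: measurableT_comp mF _.
    + by move=> y _ /=; rewrite lee_fin.
rewrite (_ : (\int[m]_x \int[m]_y (cst C%:E y))%E
            = (\int[m]_x \int[m]_y C)%:E) ?ltry//.
by rewrite !fineK_bounded_mfun//; exact: bounded_mfun_cst.
Qed.

Lemma bounded_mfun_slice1 F x : bounded_mfun F -> bounded_mfun (fun y => F (x, y)).
Proof. by apply: bounded_mfun_comp. Qed.

Lemma bounded_mfun_slice2 F y : bounded_mfun F -> bounded_mfun (fun x => F (x, y)).
Proof. by apply: bounded_mfun_comp. Qed.

(** Measurability comes from Fubini; a bound [C] on [F] gives [C] times the total mass as a bound on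
    the partial integral. *)
Lemma bounded_mfun_Rintegral F : bounded_mfun F ->
  bounded_mfun (fun x => \int[m]_y F (x, y)).
Proof.
move=> bF; split.
  apply/measurable_EFinP.
  rewrite (_ : EFin \o _ = fubini_F m (EFin \o F)).
    exact/measurable_fubini_F/integrable_prod.
  by apply/funext => x; rewrite /= fineK_bounded_mfun//; exact: bounded_mfun_slice1.
have [_ [C FC]] := bF.
exists (\int[m]_y (cst C y)) => x.
have bx := bounded_mfun_slice1 x bF.
apply: le_trans (le_normr_Rintegral _ _) _ => //.
  exact: bounded_mfun_integrable.
apply: le_Rintegral => //.
- apply: bounded_mfun_integrable; case: bx => mx _.
  by split; [exact: measurableT_comp|exists C => y; rewrite normr_id].
- exact/bounded_mfun_integrable/bounded_mfun_cst.
Qed.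

Lemma Rintegral_swap F : bounded_mfun F ->
  \int[m]_x \int[m]_y F (x, y) = \int[m]_y \int[m]_x F (x, y).
Proof.
move=> bF; rewrite /Rintegral.
transitivity (fine (\int[m]_x \int[m]_y (F (x, y))%:E)).
  congr fine; apply: eq_integral => x _.
  by rewrite -fineK_bounded_mfun//; exact: bounded_mfun_slice1.
rewrite (Fubini (integrable_prod bF)).
congr fine; apply: eq_integral => y _.
by rewrite -fineK_bounded_mfun//; exact: bounded_mfun_slice2.
Qed.

(** After the order of integration in the second double integral is exchanged, both integrands sit
    under the same iterated integral, where their sum separates. It serves to integrate partial
    fraction identities. *)
Lemma Rintegral_mul_split F1 F2 (f g : T -> R) :
  bounded_mfun F1 -> bounded_mfun F2 -> bounded_mfun f -> bounded_mfun g ->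
  (forall x y, F1 (x, y) + F2 (x, y) = f x * g y) ->
  \int[m]_x \int[m]_y F1 (x, y) + \int[m]_y \int[m]_x F2 (x, y) =
  (\int[m]_x f x) * (\int[m]_y g y).
Proof.
move=> b1 b2 bf bg E.
rewrite -(Rintegral_swap b2) -bounded_mfun_RintegralD; last 2 first.
- exact: bounded_mfun_Rintegral.
- exact: bounded_mfun_Rintegral.
transitivity (\int[m]_x ((\int[m]_y g y) * f x)); last first.
  by rewrite bounded_mfun_RintegralZl// mulrC.
apply: eq_Rintegral => x _.
rewrite -bounded_mfun_RintegralD; last 2 first.
- exact: bounded_mfun_slice1.
- exact: bounded_mfun_slice1.
rewrite mulrC -bounded_mfun_RintegralZl//.
by apply: eq_Rintegral => y _.
Qed.
End bounded_fubini.

(** * Finite products of powers *)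

Section power_product.
Context d (T : measurableType d) (R : realType).
Variables (m : {finite_measure set T -> \bar R}) (th : T -> R) (alpha : R).
Hypotheses (alpha0 : 0 < alpha) (mth : measurable_fun setT th).
Hypothesis th01 : forall v, 0 <= th v <= 1.
Hypothesis powRE : forall r, 0 < r ->
  r `^ alpha = 1 + (r - 1) * \int[m]_v (1 + (r - 1) * th v)^-1.
Variables a b : nat -> R.
Hypotheses (a_gt0 : forall i, 0 < a i) (ab : forall i, a i < b i).
Hypothesis ba : forall i, b i < a i.+1.

(** This carries [m] onto the interval $[a_i,b_i]$, in whose interior the base of [factor i] is
    negative: the branch cut of its power. *)
Definition cut_point i v := a i + (b i - a i) * th v.
Local Notation t := cut_point.

(** The variable is $x=-\lambda$, which places the cuts on the positive half-line. *)
Definition factor i x := ((1 - x / b i) / (1 - x / a i)) `^ alpha.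
Local Notation q := factor.

Definition off_cut i x := x < a i \/ b i < x.

Let b_gt0 i : 0 < b i. Proof. exact: lt_trans (ab i). Qed.

Let d_gt0 i : 0 < b i - a i. Proof. by rewrite subr_gt0. Qed.

Lemma cut_point_itv i v : a i <= t i v <= b i.
Proof.
have /andP[h0 h1] := th01 v; have d0 := d_gt0 i; rewrite /t.
by apply/andP; split; nra.
Qed.

Lemma cuts_lt i j : (i < j)%N -> b i < a j.
Proof.
elim: j => // j IH; rewrite ltnS leq_eqVlt => /predU1P[->//|/IH].
by move=> /lt_trans; apply; rewrite (lt_trans (ab j)).
Qed.

Lemma off_cut_point i k v : i != k -> off_cut i (t k v).
Proof.
have /andP[h0 h1] := cut_point_itv k v.
rewrite neq_ltn => /orP[ik|ki]; [right|left].
- exact: lt_le_trans (cuts_lt ik) h0.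
- exact: le_lt_trans h1 (cuts_lt ki).
Qed.

Lemma measurable_cut_point i : measurable_fun setT (t i).
Proof. by apply: measurable_funD => //; exact: measurable_funM. Qed.

Lemma bounded_cut_point i : bounded_mfun (t i).
Proof.
split; first exact: measurable_cut_point.
exists (b i) => v; have /andP[h0 h1] := cut_point_itv i v.
by rewrite ger0_norm// (le_trans _ h0)// ltW.
Qed.

Lemma bounded_resolvent i x : off_cut i x -> bounded_mfun (fun v => (t i v - x)^-1).
Proof.
have mt : measurable_fun setT (fun v => t i v - x).
  by apply: measurable_funB => //; exact: measurable_cut_point.
case=> hx.
- apply: (@bounded_mfunV _ _ _ _ (a i - x)) => //; first by rewrite subr_gt0.
  move=> v; have /andP[h0 _] := cut_point_itv i v.
  by rewrite (le_trans _ (ler_norm _))// lerB.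
- apply: (@bounded_mfunV _ _ _ _ (x - b i)) => //; first by rewrite subr_gt0.
  move=> v; have /andP[_ h1] := cut_point_itv i v.
  by rewrite distrC (le_trans _ (ler_norm _))// lerB.
Qed.

Let cut_sub_neq0 i x v : off_cut i x -> t i v - x != 0.
Proof.
have /andP[h0 h1] := cut_point_itv i v.
rewrite subr_eq0 => -[h|h]; first by rewrite gt_eqF// (lt_le_trans h).
by rewrite lt_eqF// (le_lt_trans h1).
Qed.

Let ratio_gt0 i x : off_cut i x -> 0 < (b i - x) / (a i - x).
Proof.
have abi := ab i.
case=> h; first by rewrite divr_gt0// subr_gt0// (lt_trans h).
by rewrite -mulrNN -invrN !opprB divr_gt0// subr_gt0// (lt_trans abi).
Qed.

Let a_sub_neq0 i x : off_cut i x -> a i - x != 0.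
Proof.
rewrite subr_eq0 => -[h|h]; first by rewrite gt_eqF.
by rewrite lt_eqF// (lt_trans (ab i)).
Qed.

Let factor_ratio i x : off_cut i x ->
  (1 - x / b i) / (1 - x / a i) = a i / b i * ((b i - x) / (a i - x)).
Proof.
move=> h; field.
by rewrite a_sub_neq0//= !gt_eqF.
Qed.

(** Apply [powRE] to $r=(b_i-x)/(a_i-x)$. Then $r-1=(b_i-a_i)/(a_i-x)$ and
    $1+(r-1)\,\mathrm{th}=(t_i-x)/(a_i-x)$, so the kernel becomes the Cauchy kernel of the cut. *)
Lemma factorE i x : off_cut i x ->
  q i x = (a i / b i) `^ alpha *
    (1 + (b i - a i) * \int[m]_v (t i v - x)^-1).
Proof.
move=> h; have r0 := ratio_gt0 h; have ax := a_sub_neq0 h.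
rewrite /q factor_ratio// powRM ?(ltW r0)//; last by rewrite ltW ?divr_gt0.
rewrite (powRE r0); congr (_ * (1 + _)).
set r := _ / _ in r0 *.
have r1 : r - 1 = (b i - a i) / (a i - x) by rewrite /r; field.
rewrite r1.
have E v : (1 + (b i - a i) / (a i - x) * th v)^-1 = (a i - x) * (t i v - x)^-1.
  rewrite -[RHS]invf_div; congr (_^-1).
  by rewrite /t; field.
under eq_Rintegral do rewrite E.
rewrite bounded_mfun_RintegralZl//; last exact: bounded_resolvent.
by field.
Qed.

(** The base is a constant times $(t_k-b_i)/(t_k-a_i)$, and its pole $a_i$ keeps a positive distance
    from cut $k$. *)
Lemma bounded_factor i k : i != k -> bounded_mfun (fun v => q i (t k v)).
Proof.
move=> ik; apply: (@bounded_mfun_powR _ _ _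
    (fun v => (1 - t k v / b i) / (1 - t k v / a i))).
- exact: ltW.
- move=> v; have h := off_cut_point v ik; rewrite factor_ratio//.
  by rewrite ltW// mulr_gt0 ?ratio_gt0// divr_gt0.
- have hk : off_cut k (a i).
    move: ik; rewrite neq_ltn => /orP[ik|ki]; [left|right].
      exact: lt_trans (ab i) (cuts_lt ik).
    exact: cuts_lt.
  have -> : (fun v => (1 - t k v / b i) / (1 - t k v / a i)) =
     (fun v => a i / b i * ((t k v - b i) * (t k v - a i)^-1)).
    apply/funext => v; rewrite factor_ratio; last exact: off_cut_point.
    by congr (_ * _); rewrite -mulrNN -invrN !opprB.
  apply: bounded_mfunM; first exact: bounded_mfun_cst.
  apply: bounded_mfunM; last exact: bounded_resolvent.
  by apply: bounded_mfunB; [exact: bounded_cut_point|exact: bounded_mfun_cst].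
Qed.

(** Density, relative to [m] along [cut_point k], of the part on cut [k] of the measure representing
    the product of the first [n] factors. Cuts [k >= n] have not entered yet and carry density 0. *)
Fixpoint cut_density n k v : R :=
  if n is n'.+1 then
    if k == n' then (a n' / b n') `^ alpha * (b n' - a n') * \prod_(i < n') q i (t n' v)
    else cut_density n' k v * q n' (t k v)
  else 0.
Local Notation D := cut_density.

Lemma cut_density_eq0 n k v : (n <= k)%N -> D n k v = 0.
Proof.
elim: n => //= n IH nk; rewrite gtn_eqF// IH ?mul0r//; exact: ltnW.
Qed.

Lemma bounded_cut_density n k : bounded_mfun (D n k).
Proof.
elim: n => [|n IH]; first exact: bounded_mfun_cst.
have [->|kn] := eqVneq k n.
  under [D _ _]eq_fun do rewrite /= eqxx.
  apply: bounded_mfunM; first exact: bounded_mfun_cst.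
  apply: (@bounded_mfun_prod _ _ _ _ (fun i v => q i (t n v))) => i ni.
  by apply: bounded_factor; rewrite ltn_eqF.
under [D _ _]eq_fun do rewrite /= (negbTE kn).
by apply: bounded_mfunM => //; apply: bounded_factor; rewrite eq_sym.
Qed.

Lemma cut_density_ge0 n k v : 0 <= D n k v.
Proof.
elim: n => //= n IH; case: eqP => [_|/eqP kn].
  by rewrite !mulr_ge0 ?powR_ge0 ?(ltW (d_gt0 _))// prodr_ge0// => i _; exact: powR_ge0.
by rewrite mulr_ge0// powR_ge0.
Qed.

(** Cut $k<n$ lies in $(0,a_n)$, and there $t/b_n<t/a_n<1$ makes the base of factor $n$ at least 1.
    For $k\ge n$ the left side is 0. *)
Lemma cut_density_le n k v : D n k v <= D n.+1 k v.
Proof.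
have [nk|kn] := leqP n k; first by rewrite cut_density_eq0// cut_density_ge0.
rewrite /= ltn_eqF// ler_peMr ?cut_density_ge0//.
rewrite /q; apply: (@le_trans _ _ (1 `^ alpha)); first by rewrite powR1.
have ta : t k v < a n.
  by have /andP[_ h] := cut_point_itv k v; exact: le_lt_trans h (cuts_lt kn).
have t0 : 0 < t k v.
  by have /andP[h _] := cut_point_itv k v; exact: lt_le_trans h.
have ta1 : 0 < 1 - t k v / a n by rewrite subr_gt0 ltr_pdivrMr ?mul1r.
have r1 : 1 <= (1 - t k v / b n) / (1 - t k v / a n).
  rewrite ler_pdivlMr// mul1r lerB// ler_pM2l// lef_pV2 ?posrE//.
  exact: ltW.
apply: ge0_ler_powR => //; first exact: ltW.
- by rewrite nnegrE.
- by rewrite nnegrE (le_trans _ r1).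
Qed.

(* The product formula is needed at negative x for the theorem, and to the right
   of the first n cuts in order to continue the induction. *)
Definition region n x := x < a 0%N \/ forall i, (i < n)%N -> b i < x.

Let region_off_cut n x k : region n x -> (k < n)%N -> off_cut k x.
Proof.
case=> [h _|h /h]; last by right.
left; case: k => // k; apply: (lt_trans h); apply: (lt_trans (ab 0%N)).
exact: cuts_lt.
Qed.

Let regionS n x : region n.+1 x -> region n x.
Proof. by case=> h; [left|right => i ni]; last exact/h/ltnW. Qed.

Let region_cut_point n v : region n (t n v).
Proof.
right => i ni; have /andP[h _] := cut_point_itv n v.
exact: lt_le_trans (cuts_lt ni) h.
Qed.

Lemma bounded_cut_gap k n : k != n ->
  bounded_mfun (fun z : T * T => (t k z.1 - t n z.2)^-1).
Proof.
have mt : measurable_fun setT (fun z : T * T => t k z.1 - t n z.2).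
  by apply: measurable_funB; exact: (measurableT_comp (measurable_cut_point _)).
rewrite neq_ltn => /orP[] lt_cuts.
- apply: (@bounded_mfunV _ _ _ _ (a n - b k)) => //; first by rewrite subr_gt0 cuts_lt.
  move=> z; have /andP[h0 _] := cut_point_itv n z.2.
  have /andP[_ h1] := cut_point_itv k z.1.
  by rewrite distrC (le_trans _ (ler_norm _))// lerB.
- apply: (@bounded_mfunV _ _ _ _ (a k - b n)) => //; first by rewrite subr_gt0 cuts_lt.
  move=> z; have /andP[h0 _] := cut_point_itv k z.1.
  have /andP[_ h1] := cut_point_itv n z.2.
  by rewrite (le_trans _ (ler_norm _))// lerB.
Qed.

(** This kernel and its mirror image [bounded_cut_kernel'] are the two terms of the partial fraction
    split, viewed on the product space where Fubini applies. *)
Lemma bounded_cut_kernel (f : T -> R) k n x : bounded_mfun f -> k != n -> off_cut n x ->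
  bounded_mfun (fun z : T * T => f z.1 / (t k z.1 - t n z.2) / (t n z.2 - x)).
Proof.
move=> bf kn hn; apply: bounded_mfunM; first apply: bounded_mfunM.
- exact: bounded_mfun_comp bf.
- exact: bounded_cut_gap.
- by apply: bounded_mfun_comp (bounded_resolvent hn).
Qed.

Lemma bounded_cut_kernel' (f : T -> R) k n x : bounded_mfun f -> k != n -> off_cut k x ->
  bounded_mfun (fun z : T * T => f z.1 / (t n z.2 - t k z.1) / (t k z.1 - x)).
Proof.
move=> bf kn hk; apply: bounded_mfunM; first apply: bounded_mfunM.
- exact: bounded_mfun_comp bf.
- rewrite eq_sym in kn.
  exact: (bounded_mfun_comp (@measurable_swap _ _ T T) (bounded_cut_gap kn)).
- by apply: bounded_mfun_comp (bounded_resolvent hk).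
Qed.

(* Integrates 1/((s-t)(t-x)) + 1/((t-s)(s-x)) = 1/((t-x)(s-x)). *)
Lemma Rintegral_cut_pair (f : T -> R) k n x : bounded_mfun f -> k != n ->
  off_cut k x -> off_cut n x ->
  \int[m]_v \int[m]_w (f v / (t n w - t k v) / (t k v - x)) +
  \int[m]_w \int[m]_v (f v / (t k v - t n w) / (t n w - x)) =
  (\int[m]_v (f v / (t k v - x))) * \int[m]_w (t n w - x)^-1.
Proof.
move=> bf kn hk hn.
apply: (@Rintegral_mul_split _ _ _ m
   (fun z : T * T => f z.1 / (t n z.2 - t k z.1) / (t k z.1 - x))
   (fun z : T * T => f z.1 / (t k z.1 - t n z.2) / (t n z.2 - x))
   (fun v => f v / (t k v - x)) (fun w => (t n w - x)^-1)).
- exact: bounded_cut_kernel'.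
- exact: bounded_cut_kernel.
- by apply: bounded_mfunM => //; exact: bounded_resolvent.
- exact: bounded_resolvent.
- move=> v w /=.
  have h1 := cut_sub_neq0 v hk; have h2 := cut_sub_neq0 w hn.
  have h3 : t n w - t k v != 0.
    by apply: cut_sub_neq0; apply: off_cut_point; rewrite eq_sym.
  have h4 : t k v - t n w != 0 by rewrite -oppr_eq0 opprB.
  by field; rewrite h1 h2 h3 h4.
Qed.

(** By induction, the formula for [n] is multiplied by [factorE] for the next factor. Each product
    of two Cauchy integrals splits into a part on the old cut and a part on the new one, and these
    parts are what the recursion of [cut_density] prescribes. *)
Lemma power_productE n x : region n x ->
  \prod_(i < n) q i x = \prod_(i < n) (a i / b i) `^ alpha
    + \sum_(k < n) \int[m]_v (D n k v / (t k v - x)).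
Proof.
elim: n x => [|n IH] x hx; first by rewrite !big_ord0 addr0.
have hn := region_off_cut hx (ltnSn n).
have hx' := regionS hx.
have hk (k : 'I_n) : off_cut k x by exact: region_off_cut hx' _.
rewrite 2!big_ord_recr big_ord_recr/=.
rewrite IH// factorE//.
set K := \prod_(i < n) (a i / b i) `^ alpha.
set kap := (a n / b n) `^ alpha; set dn := b n - a n.
have bD (k : 'I_n) : bounded_mfun (fun v => D n k v / (t k v - x)).
  by apply: bounded_mfunM; [exact: bounded_cut_density|exact: bounded_resolvent].
have bI : bounded_mfun (fun v => (t n v - x)^-1) by exact: bounded_resolvent.
(* Old cuts: the new factor, evaluated on cut [k], is expanded by [factorE]. *)
have E1 (k : 'I_n) : \int[m]_v (D n.+1 k v / (t k v - x)) =
   kap * \int[m]_v (D n k v / (t k v - x)) +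
   kap * dn * \int[m]_v \int[m]_w (D n k v / (t n w - t k v) / (t k v - x)).
  have offk v : off_cut n (t k v) by apply: off_cut_point; rewrite gtn_eqF.
  have inner v : \int[m]_w (D n k v / (t n w - t k v) / (t k v - x)) =
      D n k v / (t k v - x) * \int[m]_w (t n w - t k v)^-1.
    rewrite -bounded_mfun_RintegralZl; last exact: bounded_resolvent.
    by apply: eq_Rintegral => w _; rewrite mulrAC.
  have E v : D n.+1 k v / (t k v - x) = kap * (D n k v / (t k v - x)) +
      kap * dn * \int[m]_w (D n k v / (t n w - t k v) / (t k v - x)).
    by rewrite inner /= ltn_eqF// factorE// -/kap -/dn; ring.
  have bJ : bounded_mfun (fun v => \int[m]_w (D n k v / (t n w - t k v) / (t k v - x))).
    have kn : k != n :> nat by rewrite ltn_eqF.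
    have bk := bounded_cut_kernel' (bounded_cut_density n k) kn (hk k).
    exact: (bounded_mfun_Rintegral m bk).
  rewrite -!bounded_mfun_RintegralZl// -bounded_mfun_RintegralD; last 2 first.
  - by apply: bounded_mfunM => //; exact: bounded_mfun_cst.
  - by apply: bounded_mfunM => //; exact: bounded_mfun_cst.
  exact: eq_Rintegral.
(* New cut: the product of the earlier factors at [t n w] is expanded by the induction hypothesis,
   as [t n w] lies to the right of all earlier cuts. *)
have E2 : \int[m]_v (D n.+1 n v / (t n v - x)) =
   kap * dn * (K * \int[m]_w (t n w - x)^-1 +
     \sum_(k < n) \int[m]_w \int[m]_v (D n k v / (t k v - t n w) / (t n w - x))).
  have offn (k : 'I_n) w : off_cut k (t n w) by apply: off_cut_point; rewrite ltn_eqF.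
  pose J k w := \int[m]_v (D n k v / (t k v - t n w) / (t n w - x)).
  have inner (k : 'I_n) w :
      J k w = (t n w - x)^-1 * \int[m]_v (D n k v / (t k v - t n w)).
    rewrite -bounded_mfun_RintegralZl.
      by apply: eq_Rintegral => v _; rewrite mulrC.
    by apply: bounded_mfunM; [exact: bounded_cut_density|exact: bounded_resolvent].
  have bJ (k : 'I_n) : bounded_mfun (J k).
    have kn : k != n :> nat by rewrite ltn_eqF.
    have bk := bounded_cut_kernel (bounded_cut_density n k) kn hn.
    exact: (bounded_mfun_Rintegral m (bounded_mfun_comp (@measurable_swap _ _ T T) bk)).
  have E w : D n.+1 n w / (t n w - x) =
      kap * dn * (K * (t n w - x)^-1 + \sum_(k < n) J k w).
    rewrite /= eqxx IH; last exact: region_cut_point.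
    under eq_bigr do rewrite inner.
    by rewrite -mulr_sumr -/kap -/dn -/K; ring.
  under eq_Rintegral do rewrite E.
  have bS : bounded_mfun (fun w => \sum_(k < n) J k w) by exact: bounded_mfun_sum.
  have bK : bounded_mfun (fun w => K * (t n w - x)^-1).
    by apply: bounded_mfunM => //; exact: bounded_mfun_cst.
  rewrite bounded_mfun_RintegralZl; last exact: bounded_mfunD.
  rewrite bounded_mfun_RintegralD// bounded_mfun_RintegralZl//.
  by rewrite bounded_mfun_Rintegral_sum.
rewrite (eq_bigr _ (fun k _ => E1 k)) E2 big_split/= -!mulr_sumr.
set S := \sum_(k < n) \int[m]_v (D n k v / (t k v - x)).
set I := \int[m]_v (t n v - x)^-1.
set S1 := \sum_(k < n) \int[m]_v _; set S2 := \sum_(k < n) \int[m]_w _.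
(* The cross terms left over on the old cuts and on the new cut add up to the product of the two
   Cauchy integrals. *)
have : S1 + S2 = S * I.
  rewrite /S1 /S2 -big_split/= /S mulr_suml; apply: eq_bigr => k _.
  by rewrite Rintegral_cut_pair ?ltn_eqF//; exact: bounded_cut_density.
move=> h.
transitivity (K * kap + kap * S + kap * dn * K * I + kap * dn * (S1 + S2)).
  by rewrite h; ring.
by ring.
Qed.
End power_product.

(** * Limits of products *)

(** Weight [m] by [D], then push forward along [tau]. The sign of [f] is required on [E] alone
    because $1/(l+s)$ is negative for $s<-l$; as [tau] takes values in [E], the restriction loses no
    mass. *)
Lemma pushed_density_measure d (T : measurableType d) (R : realType)
    (m : {measure set T -> \bar R}) (D : T -> R) (tau : T -> measurableTypeR R) :
  measurable_fun setT D -> (forall v, 0 <= D v) -> measurable_fun setT tau ->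
  exists nu : {measure set (measurableTypeR R) -> \bar R},
    forall (E : set R) (f : R -> R), measurable E -> measurable_fun setT f ->
      (forall s, E s -> 0 <= f s) -> (forall v, E (tau v)) ->
      (\int[nu]_(s in E) (f s)%:E = \int[m]_v (D v * f (tau v))%:E)%E.
Proof.
move=> mD D0 mtau.
have [nu nuE] := measure_with_density m mD D0.
unshelve eexists (pushforward nu tau : {measure set (measurableTypeR R) -> \bar R}).
  exact: mtau.
move=> E f mE mf f0 Etau.
rewrite ge0_integral_pushforward//.
- rewrite (_ : tau @^-1` E = setT); last by apply/seteqP; split => v // _; exact: Etau.
  rewrite nuE.
  + by apply: eq_integral => v _; rewrite /= -EFinM mulrC.
  + by apply/measurable_EFinP; exact: measurableT_comp mtau.
  + by move=> v; rewrite /= lee_fin f0.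
- by apply/measurable_EFinP; exact: measurable_funTS.
- by move=> s /set_mem Es; rewrite lee_fin f0.
Qed.

Section stieltjes_limit.
Context d (T : measurableType d) (R : realType).
Variables (m : {finite_measure set T -> \bar R}) (th : T -> R) (alpha : R).
Hypotheses (alpha0 : 0 < alpha) (mth : measurable_fun setT th).
Hypothesis th01 : forall v, 0 <= th v <= 1.
Hypothesis powRE : forall r, 0 < r ->
  r `^ alpha = 1 + (r - 1) * \int[m]_v (1 + (r - 1) * th v)^-1.
Variables a b : nat -> R.
Hypotheses (a_gt0 : forall i, 0 < a i) (ab : forall i, a i < b i).
Hypothesis ba : forall i, b i < a i.+1.
Local Notation D := (cut_density th alpha a b).
Local Notation t := (cut_point th a b).
Local Notation q := (factor alpha a b).

Let cut_gt0 k v : 0 < t k v.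
Proof.
by have /andP[h _] := cut_point_itv th01 ab k v; exact: lt_le_trans h.
Qed.

Let bD n k : bounded_mfun (D n k).
Proof. exact: bounded_cut_density. Qed.

Let mt k : measurable_fun setT (t k).
Proof. exact: measurable_cut_point. Qed.

(** By [cut_density_le] the increments are nonnegative, hence true densities on the first [n.+1]
    cuts; the measure is the sum of their pushforwards. *)
Lemma increment_measure n :
  exists nu : {measure set (measurableTypeR R) -> \bar R},
    forall f : R -> R, measurable_fun setT f -> (forall s, 0 < s -> 0 <= f s) ->
      (\int[nu]_(s in `]0%R, +oo[) (f s)%:E =
       \sum_(k < n.+1) \int[m]_v ((D n.+1 k v - D n k v) * f (t k v))%:E)%E.
Proof.
have mDD k : measurable_fun setT (fun v => D n.+1 k v - D n k v).
  by have [] := bounded_mfunB (bD n.+1 k) (bD n k).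
have DD0 k v : 0 <= D n.+1 k v - D n k v by rewrite subr_ge0; exact: cut_density_le.
have [nu nuE] := choice (fun k => pushed_density_measure m (mDD k) (DD0 k) (mt k)).
exists (msum nu n.+1 : {measure set (measurableTypeR R) -> \bar R}) => f mf f0.
rewrite ge0_integral_measure_sum//=; last 2 first.
- by move=> s; rewrite in_itv/= andbT => s0; rewrite lee_fin f0.
- by apply/measurable_EFinP; exact: measurable_funTS.
apply: eq_bigr => k _; apply: nuE => //.
- by move=> s /=; rewrite in_itv/= andbT; exact: f0.
- by move=> v /=; rewrite in_itv/= andbT.
Qed.

(** The constant terms [K n] converge, and the increment measures are summed into [sigma]. The
    partial sums of its resolvent integral telescope to the product minus [K n], which tends to
    [h l - limn K]. *)
Theorem stieltjes_of_product_limit (h : R -> R) :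
  (forall l, 0 < l -> 0 <= h l) ->
  (forall l, 0 < l -> \prod_(i < n) q i (- l) @[n --> \oo] --> h l) ->
  stieltjes_function h.
Proof.
move=> h0 hl; split => //.
pose K n := \prod_(i < n) (a i / b i) `^ alpha.
have b0 i : 0 < b i by exact: lt_trans (ab i).
have K0 n : 0 <= K n by apply: prodr_ge0 => i _; exact: powR_ge0.
(* Each factor $(a_i/b_i)^\alpha$ is at most 1, so [K] decreases and stays nonnegative. *)
have cK : cvgn K.
  apply: nonincreasing_is_cvgn.
    apply/nonincreasing_seqP => n; rewrite {1}/K big_ord_recr/=.
    apply: ler_piMr; first exact: K0.
    apply: (@le_trans _ _ (1 `^ alpha)); last by rewrite powR1.
    apply: ge0_ler_powR; rewrite ?nnegrE ?(ltW alpha0)//.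
      by rewrite divr_ge0// ltW.
    by rewrite ler_pdivrMr// mul1r ltW.
  by exists 0 => _ [n _ <-].
have [nu nuE] := choice increment_measure.
pose sigma : {measure set (measurableTypeR R) -> \bar R} := mseries nu 0.
have bres l k : 0 < l -> bounded_mfun (fun v => (l + t k v)^-1).
  move=> l0; have -> : (fun v => (l + t k v)^-1) = (fun v => (t k v - (- l))^-1).
    by apply/funext => v; rewrite opprK addrC.
  apply: bounded_resolvent => //; left; rewrite (lt_trans _ (a_gt0 k))//.
  by rewrite oppr_lt0.
pose S l n := \sum_(k < n) \int[m]_v (D n k v / (l + t k v)).
have SS l n : 0 < l -> S l n.+1 = S l n +
    \sum_(k < n.+1) \int[m]_v ((D n.+1 k v - D n k v) / (l + t k v)).
  move=> l0.
  (* Cut [n] has density 0 at stage [n], so adding it permits a termwise comparison with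
     [S l n.+1]. *)
  have -> : S l n = \sum_(k < n.+1) \int[m]_v (D n k v / (l + t k v)).
    rewrite big_ord_recr/= [X in _ + X](_ : _ = 0) ?addr0//.
    under eq_Rintegral do rewrite cut_density_eq0// mul0r.
    by rewrite Rintegral_cst// mul0r.
  rewrite -big_split/=; apply: eq_bigr => k _.
  rewrite -bounded_mfun_RintegralD; last 2 first.
  - by apply: bounded_mfunM => //; exact: bres.
  - by apply: bounded_mfunM; [exact: (bounded_mfunB (bD n.+1 k) (bD n k))|exact: bres].
  by apply: eq_Rintegral => v _; rewrite -mulrDl; congr (_ / _); rewrite [RHS]addrC subrK.
have PE l n : 0 < l -> \prod_(i < n) q i (- l) = K n + S l n.
  move=> l0; rewrite (power_productE alpha0 mth th01 powRE) //.
    congr (_ + _); apply: eq_bigr => k _; apply: eq_Rintegral => v _.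
    by rewrite opprK addrC.
  by left; rewrite (lt_trans _ (a_gt0 0%N))// oppr_lt0.
have sigmaE l : 0 < l ->
    (\int[sigma]_(s in `]0%R, +oo[) ((l + s)^-1)%:E = (h l - limn K)%:E)%E.
  move=> l0.
  have ml : measurable_fun setT (fun s : measurableTypeR R => (l + s)^-1).
    by apply: measurable_funV; apply: measurable_funD.
  have l_ge0 s : 0 < s -> 0 <= (l + s)^-1.
    by move=> s0; rewrite invr_ge0 ltW// addr_gt0.
  rewrite ge0_integral_measure_series//; last 2 first.
  - by move=> s /=; rewrite in_itv/= andbT => s0; rewrite lee_fin l_ge0.
  - by apply/measurable_EFinP; exact: measurable_funTS.
  apply/cvg_lim => //.
  rewrite [X in X @ _ --> _](_ : _ = EFin \o S l).
    apply: cvg_EFin; first exact: nearW.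
    have -> : fine \o (EFin \o S l) = fun n => \prod_(i < n) q i (- l) - K n.
      by apply/funext => n /=; rewrite PE// addrC addKr.
    by apply: cvgB; [exact: hl|].
  apply/funext => n /=; elim: n => [|n IH]; first by rewrite big_geq// /S big_ord0.
  rewrite big_nat_recr//= IH SS// EFinD nuE//; congr (_ + _)%E.
  rewrite -sumEFin; apply: eq_bigr => k _.
  rewrite fineK_bounded_mfun//.
  by apply: bounded_mfunM; [exact: (bounded_mfunB (bD n.+1 k) (bD n k))|exact: bres].
exists 0, (limn K), sigma; split => //.
- by apply: limr_ge => //; exact: nearW.
(* The integrability condition is [sigmaE] at [l = 1], whose right side is finite. *)
- by rewrite sigmaE// ltry.
- by move=> l l0; rewrite sigmaE// mul0r add0r -EFinD addrC subrK.
Qed.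
End stieltjes_limit.

(** * The product for tanh *)

Section wallis.
Context {R : realType}.
Implicit Types x t : R.
Local Notation mu := (@lebesgue_measure R).

Let is_derive_expRN x : is_derive x 1 (fun t : R => expR (- t)) (- expR (-x)).
Proof. by apply: is_derive_eq; rewrite mulrN1. Qed.

Let is_derive_mulx x t : is_derive t 1 (fun t => x * t) x.
Proof. by apply: is_derive_eq; rewrite /GRing.scale /= mulr1. Qed.

Lemma is_derive_cosh x : is_derive x 1 (@cosh R) (sinh x).
Proof.
rewrite /cosh /sinh; have h := is_derive_expRN x.
by apply: is_derive_eq; rewrite /GRing.scale /=; field.
Qed.

Lemma is_derive_sinh x : is_derive x 1 (@sinh R) (cosh x).
Proof.
rewrite /cosh /sinh; have h := is_derive_expRN x.
by apply: is_derive_eq; rewrite /GRing.scale /=; field.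
Qed.

Lemma is_derive_cosh_lin x t : is_derive t 1 (fun t => cosh (x * t)) (x * sinh (x * t)).
Proof.
have h := is_derive_cosh (x * t).
have hx := is_derive_mulx x t.
by rewrite mulrC; exact: (@is_derive1_comp _ (@cosh R) (fun t => x * t)).
Qed.

Lemma is_derive_sinh_lin x t : is_derive t 1 (fun t => sinh (x * t)) (x * cosh (x * t)).
Proof.
have h := is_derive_sinh (x * t).
have hx := is_derive_mulx x t.
by rewrite mulrC; exact: (@is_derive1_comp _ (@sinh R) (fun t => x * t)).
Qed.

Let is_derive_cosX n t :
  is_derive t 1 (fun t : R => cos t ^+ n) (- (n%:R * cos t ^+ n.-1 * sin t)).
Proof.
have := @is_deriveX _ _ (@cos R) n t 1 _ (is_derive_cos t).
move=> h; apply: is_derive_eq.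
  rewrite (_ : (fun t => cos t ^+ n) = (@cos R) ^+ n); last first.
    by apply/funext => y; rewrite fctE.
  exact: h.
by rewrite /GRing.scale /=; ring.
Qed.

(* The combination for which the sinh (x t) sin t terms of the derivative cancel;
   the truncations n.-1 and n.-2 are harmless as they come with a factor 0. *)
Definition coshcos_primitive x n t : R :=
  n%:R * (cosh (x * t) * (cos t ^+ n.-1 * sin t)) + x * (sinh (x * t) * cos t ^+ n).

Lemma is_derive_coshcos_primitive x n t : is_derive t 1 (coshcos_primitive x n)
    ((n%:R ^+ 2 + x ^+ 2) * (cosh (x * t) * cos t ^+ n)
     - n%:R * n.-1%:R * (cosh (x * t) * cos t ^+ n.-2)).
Proof.
have h1 := @is_derive_cosh_lin x t.
have h2 := @is_derive_sinh_lin x t.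
have h3 := is_derive_cosX n t.
have h4 := is_derive_cosX n.-1 t.
have h5 := is_derive_sin t.
have h6 := is_deriveM h1 (is_deriveM h4 h5).
have h7 := is_deriveM h2 h3.
have h8 := is_deriveD (is_deriveZ n%:R h6) (is_deriveZ x h7).
apply: (is_derive_eq h8).
rewrite !fctE /GRing.scale /=.
have s2 := sin2cos2 t.
case: n {h3 h4 h6 h7 h8} => [|[|n]] /=.
- ring.
- have -> : cos t ^+ 1 = cos t by [].
  ring: s2.
- rewrite !exprS -natr1 -[n.+1%:R]natr1. ring: s2.
Qed.

(** At [x = 0] these are the classical Wallis integrals, which supply the normalization of the
    product. *)
Definition wallis x n := (\int[mu]_(t in `[0, (pi / 2)]) (cosh (x * t) * cos t ^+ n))%R.

Lemma continuous_cosh_cos x n : continuous (fun t : R => cosh (x * t) * cos t ^+ n).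
Proof.
move=> t.
have h := is_deriveM (is_derive_cosh_lin x t) (is_derive_cosX n t).
apply: differentiable_continuous; apply/derivable1_diffP.
exact: (@ex_derive _ _ _ _ _ _ _ h).
Qed.

Let integrable_continuous (f : R -> R) : continuous f ->
  mu.-integrable `[0, (pi / 2)] (EFin \o f).
Proof.
move=> cf; apply: continuous_compact_integrable; first exact: segment_compact.
exact/continuous_subspaceT.
Qed.

Lemma wallis_rec x n :
  (n%:R ^+ 2 + x ^+ 2) * wallis x n - n%:R * n.-1%:R * wallis x n.-2 =
  coshcos_primitive x n (pi / 2) - coshcos_primitive x n 0.
Proof.
have cc := @continuous_cosh_cos x.
pose f t := (n%:R ^+ 2 + x ^+ 2) * (cosh (x * t) * cos t ^+ n)
     - n%:R * n.-1%:R * (cosh (x * t) * cos t ^+ n.-2).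
have c1 : continuous (fun t => (n%:R ^+ 2 + x ^+ 2) * (cosh (x * t) * cos t ^+ n)).
  by move=> t; apply: cvgM; [exact: cvg_cst|exact: cc].
have c2 : continuous (fun t => n%:R * n.-1%:R * (cosh (x * t) * cos t ^+ n.-2)).
  by move=> t; apply: cvgM; [exact: cvg_cst|exact: cc].
have cf : continuous f by move=> t; apply: cvgB; [exact: c1|exact: c2].
have ->: (n%:R ^+ 2 + x ^+ 2) * wallis x n - n%:R * n.-1%:R * wallis x n.-2 =
    \int[mu]_(t in `[0, (pi / 2)]) f t.
  rewrite /wallis -!RintegralZl//; do ?exact: integrable_continuous.
  by rewrite -RintegralB//; exact: integrable_continuous.
have dG t := is_derive_coshcos_primitive x n t.
have cG : continuous (coshcos_primitive x n).
  move=> t; apply: differentiable_continuous; apply/derivable1_diffP.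
  exact: (@ex_derive _ _ _ _ _ _ _ (dG t)).
rewrite /Rintegral (@continuous_FTC2 _ f (coshcos_primitive x n)) //.
- by rewrite divr_gt0 ?pi_gt0.
- exact/continuous_subspaceT.
- split.
  + by move=> t _; exact: (@ex_derive _ _ _ _ _ _ _ (dG t)).
  + by apply: cvg_at_right_filter; exact: cG.
  + by apply: cvg_at_left_filter; exact: cG.
- by move=> t _; rewrite derive1E (@derive_val _ _ _ _ _ _ _ (dG t)).
Qed.

Lemma coshcos_primitive0 x n : coshcos_primitive x n 0 = 0.
Proof.
by rewrite /coshcos_primitive sin0 mulr0 /sinh oppr0 subrr; ring.
Qed.

(** The boundary terms of the recursion produce a sinh at index 0 and, in [wallis1], a cosh at index
    1; this is where tanh enters. *)
Lemma wallis0 x : x * wallis x 0 = sinh (x * (pi / 2)).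
Proof.
have [->|x0] := eqVneq x 0; first by rewrite mul0r mul0r /sinh oppr0 subrr mul0r.
apply: (mulfI x0).
have := wallis_rec x 0; rewrite coshcos_primitive0 /coshcos_primitive /=.
by rewrite expr0 => h; lra.
Qed.

Lemma wallis00 : wallis 0 0 = pi / 2 :> R.
Proof.
rewrite /wallis (@eq_Rintegral _ _ _ mu _ (cst 1)); last first.
  by move=> t _; rewrite mul0r expr0 mulr1 /cosh oppr0 expR0 /=; field.
rewrite Rintegral_cst// mul1r [X in fine X](@lebesgue_measure_itv R `[0, (pi/2)]).
rewrite /= lte_fin divr_gt0 ?pi_gt0//=.
by rewrite subr0.
Qed.

Lemma wallis1 x : (1 + x ^+ 2) * wallis x 1 = cosh (x * (pi / 2)).
Proof.
have := wallis_rec x 1; rewrite coshcos_primitive0 /coshcos_primitive /=.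
rewrite cos_pihalf sin_pihalf expr0 expr1 expr1n => h. lra.
Qed.

Lemma wallisSS x n :
  (n.+2%:R ^+ 2 + x ^+ 2) * wallis x n.+2 = n.+2%:R * n.+1%:R * wallis x n.
Proof.
have := wallis_rec x n.+2; rewrite coshcos_primitive0 /coshcos_primitive /=.
by rewrite cos_pihalf !expr0n /= !(mul0r, mulr0) addr0 subr0; lra.
Qed.

Lemma cosh_gt0 x : 0 < cosh x.
Proof. by rewrite /cosh divr_gt0// addr_gt0 ?expR_gt0. Qed.

Lemma wallisS_le x n : wallis x n.+1 <= wallis x n.
Proof.
apply: le_Rintegral => //; try exact/integrable_continuous/continuous_cosh_cos.
move=> t /=; rewrite in_itv/= => /andP[t0 t1].
rewrite ler_wpM2l ?(ltW (cosh_gt0 _))// exprS ler_piMl ?cos_le1// exprn_ge0//.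
by apply: cos_ge0_pihalf; rewrite t1 andbT (le_trans _ t0)// oppr_le0 divr_ge0 ?pi_ge0.
Qed.

Lemma wallis_gt0 x n : 0 <= x -> 0 < wallis x n.
Proof.
move=> x0.
have pi2 : 0 < pi / 2 :> R by rewrite divr_gt0 ?pi_gt0.
suff [] : 0 < wallis x n /\ 0 < wallis x n.+1 by [].
elim: n => [|n [h0 h1]]; split => //.
(* At [x = 0] the identity [wallis0] reads $0=0$, so the explicit value $\pi/2$ is used instead. *)
- move: x0; rewrite le_eqVlt => /predU1P[<-|x0]; first by rewrite wallis00.
  rewrite -(pmulr_rgt0 _ x0) wallis0 /sinh divr_gt0// subr_gt0 ltr_expR.
  have := mulr_gt0 x0 pi2; lra.
- have x1 : 0 < 1 + x ^+ 2 by rewrite ltr_wpDr ?sqr_ge0.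
  by rewrite -(pmulr_rgt0 _ x1) wallis1 cosh_gt0.
- have x1 : 0 < n.+2%:R ^+ 2 + x ^+ 2 by rewrite ltr_wpDr ?sqr_ge0 ?exprn_gt0.
  by rewrite -(pmulr_rgt0 _ x1) wallisSS !mulr_gt0.
Qed.

(** * Poles and zeros of $\tanh\sqrt z/\sqrt z$, up to sign, and convergence of the product *)

Definition tanh_pole n : R := (n.*2.+1%:R * (pi / 2)) ^+ 2.
Definition tanh_zero n : R := (n.*2.+2%:R * (pi / 2)) ^+ 2.

Let wallis_ratio x n := wallis x n.*2 / wallis x n.*2.+1.

Let wallis_ratio_gt0 x n : 0 <= x -> 0 < wallis_ratio x n.
Proof. by move=> x0; rewrite divr_gt0 ?wallis_gt0. Qed.

(** Divide the recursions for the indices $2n+2$ and $2n+3$. The zero of index $n$ gets paired with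
    the pole of index $n+1$. *)
Let wallis_ratioS x n : 0 <= x ->
  wallis_ratio x n = wallis_ratio x n.+1 *
   ((n.*2.+2%:R ^+ 2 + x ^+ 2) / (n.*2.+3%:R ^+ 2 + x ^+ 2)
     * (n.*2.+3%:R / n.*2.+1%:R)).
Proof.
move=> x0; rewrite /wallis_ratio doubleS.
have := wallisSS x n.*2; have := wallisSS x n.*2.+1.
have := wallis_gt0 n.*2 x0; have := wallis_gt0 n.*2.+1 x0.
have := wallis_gt0 n.*2.+2 x0; have := wallis_gt0 n.*2.+3 x0.
move: (wallis x n.*2) (wallis x n.*2.+1) (wallis x n.*2.+2) (wallis x n.*2.+3).
move=> w0 w1 w2 w3 w30 w20 w10 w00.
have [a0 b0 c0] :
    [/\ 0 < n.*2.+1%:R :> R, 0 < n.*2.+2%:R :> R & 0 < n.*2.+3%:R :> R] by [].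
have x2 := sqr_ge0 x.
move: (n.*2.+1%:R) (n.*2.+2%:R) (n.*2.+3%:R) a0 b0 c0 => a b c a0 b0 c0 e1 e2.
have e1' : w1 = (c ^+ 2 + x ^+ 2) * w3 / (c * b).
  by rewrite e1 mulrAC divff ?mul1r// gt_eqF// mulr_gt0.
have e2' : w0 = (b ^+ 2 + x ^+ 2) * w2 / (b * a).
  by rewrite e2 mulrAC divff ?mul1r// gt_eqF// mulr_gt0.
rewrite e1' e2'; field.
by rewrite !gt_eqF// ltr_wpDr// exprn_gt0.
Qed.

(** The integrals decrease in the index, so the ratio lies between 1 and $W_{2n+1}/W_{2n+3}$, which
    the recursion gives explicitly. *)
Let wallis_ratio_bounds x n : 0 <= x ->
  1 <= wallis_ratio x n.+1 <= 1 + (1 + x ^+ 2) * n.+1%:R^-1.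
Proof.
move=> x0; have x2 := sqr_ge0 x.
rewrite /wallis_ratio ler_pdivlMr ?wallis_gt0// mul1r wallisS_le/=.
rewrite ler_pdivrMr ?wallis_gt0// doubleS.
apply: (le_trans (wallisS_le _ _)).
have := wallisSS x n.*2.+1; have := wallis_gt0 n.*2.+3 x0.
move: (wallis x n.*2.+1) (wallis x n.*2.+3) => w1 w3 w30 e1.
have nE : n.*2.+2%:R = 2 * n.+1%:R :> R by rewrite -natrM mul2n doubleS.
have nE3 : n.*2.+3%:R = 2 * n.+1%:R + 1 :> R by rewrite -nE natr1.
move: e1; rewrite nE nE3.
have m1 : 1 <= n.+1%:R :> R by rewrite ler1n.
move: (n.+1%:R) m1 => m m1 e1.
have m0 : 0 < m by lra.
have -> : w1 = ((2 * m + 1) ^+ 2 + x ^+ 2) / ((2 * m + 1) * (2 * m)) * w3.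
  rewrite mulrAC e1 mulrAC divff ?mul1r// gt_eqF// !mulr_gt0//; lra.
rewrite ler_pM2r// ler_pdivrMr; last by rewrite !mulr_gt0//; lra.
rewrite [leRHS]mulrDl mul1r.
have -> : (1 + x ^+ 2) / m * ((2 * m + 1) * (2 * m)) = (1 + x ^+ 2) * ((2 * m + 1) * 2).
  by field; rewrite gt_eqF.
nra.
Qed.

Let wallis_ratio_cvg x : 0 <= x -> wallis_ratio x n @[n --> \oo] --> (1 : R).
Proof.
move=> x0; rewrite -(cvg_shiftS (wallis_ratio x)).
apply: (@squeeze_cvgr _ _ _ _ (cst 1) (fun n => 1 + (1 + x ^+ 2) * n.+1%:R^-1)).
- by apply: nearW => n; exact: wallis_ratio_bounds.
- exact: cvg_cst.
- rewrite -[X in _ --> X]addr0; apply: cvgD; first exact: cvg_cst.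
  rewrite -[X in _ --> X](mulr0 (1 + x ^+ 2)); apply: cvgM; first exact: cvg_cst.
  exact: cvg_harmonic.
Qed.

(** The target [F] equals [Psi n * P n] for every [n]: it is [Psi 0], and each step moves one factor
    from [Psi] to the product. Since [Psi n] tends to 1, [P n] tends to [F]. *)
Lemma tanh_ratio_cvg l : 0 < l ->
  \prod_(i < n) ((1 + l / tanh_zero i) / (1 + l / tanh_pole i)) @[n --> \oo]
    --> tanh (Num.sqrt l) / Num.sqrt l.
Proof.
move=> l0.
set P := fun n => _; set F := tanh _ / _.
have pi0 : 0 < pi / 2 :> R by rewrite divr_gt0 ?pi_gt0.
(* With this scaling $l=(x\pi/2)^2$, and the factors $\pi/2$ in the poles and zeros cancel. *)
pose x := Num.sqrt l / (pi / 2).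
have s0 : 0 < Num.sqrt l by rewrite sqrtr_gt0.
have x0 : 0 < x by rewrite divr_gt0.
have x0' := ltW x0.
have xE : x * (pi / 2) = Num.sqrt l by rewrite /x divfK// gt_eqF.
have lE : l = (x * (pi / 2)) ^+ 2 by rewrite xE sqr_sqrtr// ltW.
clearbody x.
(* Dividing by the ratio at 0 normalizes each factor to value 1 at [x = 0]. The last factor repairs
   the index shift of [wallis_ratioS], pairing zero [n] with pole [n]. *)
pose Psi n := wallis_ratio x n / wallis_ratio 0 n * (1 + x ^+ 2 / n.*2.+1%:R ^+ 2)^-1.
have Psi_gt0 n : 0 < Psi n.
  apply: divr_gt0; first by rewrite divr_gt0 ?wallis_ratio_gt0.
  by rewrite ltr_wpDr// divr_ge0 ?sqr_ge0.
have FE : F = Psi 0%N.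
  rewrite /F /Psi /wallis_ratio /=.
  have e0 := wallis0 x; have e1 := wallis1 x.
  have := wallis1 0; rewrite mul0r expr0n addr0 mul1r /cosh oppr0 expR0 => e01.
  rewrite xE in e0 e1.
  have c0 := cosh_gt0 (Num.sqrt l); have w0 := wallis_gt0 0 x0'.
  have w1 := wallis_gt0 1 x0'.
  have x1 : 0 < 1 + x ^+ 2 by rewrite ltr_wpDr ?sqr_ge0.
  rewrite /tanh -e0 -e1 wallis00 e01 -xE.
  rewrite double0 expr1n divr1.
  move: (pi / 2) pi0 => q q0.
  by field; rewrite !gt_eqF.
have PsiS n : Psi n = Psi n.+1 * ((1 + l / tanh_zero n) / (1 + l / tanh_pole n)).
  rewrite /Psi (wallis_ratioS _ x0') (@wallis_ratioS 0)// doubleS expr0n /=.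
  rewrite lE /tanh_zero /tanh_pole.
  have := wallis_ratio_gt0 n.+1 x0'; have := @wallis_ratio_gt0 0 n.+1 (lexx _).
  move: (wallis_ratio _ _) (wallis_ratio _ _) => r0 r r00 r_0.
  have [a0 b0 c0] :
    [/\ 0 < n.*2.+1%:R :> R, 0 < n.*2.+2%:R :> R & 0 < n.*2.+3%:R :> R] by [].
  move: (n.*2.+1%:R) (n.*2.+2%:R) (n.*2.+3%:R) a0 b0 c0 => a b c a0 b0 c0.
  move: (pi / 2) pi0 => q q0.
  have [? ? ?] : [/\ 0 < a ^+ 2, 0 < b ^+ 2 & 0 < c ^+ 2] by rewrite !exprn_gt0.
  have x2 : 0 < x ^+ 2 by rewrite exprn_gt0.
  by field; rewrite !gt_eqF //= ?addr_gt0.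
have FP n : P n = F / Psi n.
  suff -> : F = Psi n * P n by rewrite mulrAC divff ?mul1r// gt_eqF.
  elim: n => [|n ->]; first by rewrite /P big_ord0 FE mulr1.
  by rewrite /P big_ord_recr/= PsiS; ring.
have Psi1 : Psi n @[n --> \oo] --> (1 : R).
  have cv0 : (1 + x ^+ 2 / n.*2.+1%:R ^+ 2)^-1 @[n --> \oo] --> (1 : R).
    rewrite -[X in _ --> X]invr1; apply: cvgV; first exact: oner_neq0.
    apply: (@squeeze_cvgr _ _ _ _ (cst 1) (fun n => 1 + x ^+ 2 * n.+1%:R^-1)).
    - apply: nearW => n /=; rewrite lerDl divr_ge0 ?sqr_ge0//= lerD2l.
      rewrite ler_wpM2l ?sqr_ge0// lef_pV2 ?posrE ?exprn_gt0//.
      rewrite -natrX ler_nat (@leq_trans n.*2.+1)//; last by rewrite -mulnn leq_pmulr.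
      by rewrite ltnS -addnn leq_addr.
    - exact: cvg_cst.
    - rewrite -[X in _ --> X]addr0; apply: cvgD; first exact: cvg_cst.
      rewrite -[X in _ --> X](mulr0 (x ^+ 2)); apply: cvgM; first exact: cvg_cst.
      exact: cvg_harmonic.
  have -> : (1 : R) = 1 / 1 * 1 by rewrite divr1 mulr1.
  apply: cvgM => //; apply: cvgM; first exact: wallis_ratio_cvg.
  by apply: cvgV; [exact: oner_neq0|exact: wallis_ratio_cvg].
rewrite (_ : P = fun n => F / Psi n); last exact/funext.
rewrite -[X in _ --> X]divr1; apply: cvgM; first exact: cvg_cst.
by apply: cvgV => //; exact: oner_neq0.
Qed.
End wallis.

(** * Application to the powers of [g] *)

Lemma cvg_powR (R : realType) (u : nat -> R) (l p : R) : 0 < l ->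
  u n @[n --> \oo] --> l -> u n `^ p @[n --> \oo] --> l `^ p.
Proof.
move=> l0 ul; have cl : {for l, continuous (fun x : R => x `^ p)}.
  apply: differentiable_continuous; apply/derivable1_diffP.
  by apply: derivable_powR; rewrite in_itv/= andbT.
exact: (cvg_comp _ _ ul cl).
Qed.

Theorem proposition2p22 (R : realType) (alpha : R)
    (halpha0 : 0 < alpha) (halpha1 : alpha <= 1) :
  stieltjes_function (fun l : R => g l `^ (2 * alpha)).
Proof.
have [m [th [mth th01 powRE]]] := powR_representation halpha0 halpha1.
have pi2 : 0 < pi / 2 :> R by rewrite divr_gt0 ?pi_gt0.
have lt_sq (i j : nat) : (i < j)%N ->
    (i%:R * (pi / 2)) ^+ 2 < (j%:R * (pi / 2)) ^+ 2 :> R.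
  have p0 (k : nat) : k%:R * (pi / 2) \is @Num.nneg R.
    by rewrite nnegrE mulr_ge0// ltW.
  by move=> ij; rewrite ltr_pXn2r// ltr_pM2r// ltr_nat.
have pole_gt0 i : 0 < tanh_pole i :> R by rewrite exprn_gt0// mulr_gt0.
apply: (stieltjes_of_product_limit halpha0 mth th01 powRE pole_gt0
          (b := @tanh_zero R)).
- by move=> i; apply: lt_sq.
- by move=> i; rewrite /tanh_pole doubleS; exact: lt_sq.
- by move=> l _; exact: powR_ge0.
- move=> l l0.
  (* Positivity of the limit gives continuity of the power there. *)
  have F0 : 0 < tanh (Num.sqrt l) / Num.sqrt l.
    have s0 : 0 < Num.sqrt l by rewrite sqrtr_gt0.
    rewrite divr_gt0// divr_gt0 ?cosh_gt0// divr_gt0// subr_gt0 ltr_expR; lra.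
  have -> : g l `^ (2 * alpha) = (tanh (Num.sqrt l) / Num.sqrt l) `^ alpha.
    by rewrite /g powRrM powR_mulrn ?sqrtr_ge0// sqr_sqrtr// ltW.
  (* All bases are nonnegative, so the power commutes with the finite product. *)
  have E n : \prod_(i < n) factor alpha tanh_pole tanh_zero i (- l) =
      (\prod_(i < n) ((1 + l / tanh_zero i) / (1 + l / tanh_pole i))) `^ alpha.
    have f0 i : 0 <= (1 + l / tanh_zero i) / (1 + l / tanh_pole i).
      by rewrite divr_ge0// addr_ge0// divr_ge0 ?sqr_ge0// ltW.
    elim: n => [|n IH]; first by rewrite !big_ord0 powR1.
    rewrite 2!big_ord_recr/= IH powRM ?prodr_ge0//.
    by rewrite /factor !mulNr !opprK.
  under eq_fun do rewrite E.
  by apply: cvg_powR => //; exact: tanh_ratio_cvg.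
Qed.
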